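(* Let $(R,\mathfrak{m})$ be a local ring of prime characteristic $p>0$ with $\dim R>0$, let $M$ be a finitely generated $R$-module, and let $s>0$ be a real number. Let $\mathfrak{m}\ltimes\mathfrak{m}M=\{(a,x):a\in\mathfrak{m},\ x\in\mathfrak{m}M\}$, an ideal of the idealization $R\ltimes M$. Then $$h_s(R\ltimes M)\leq h_s(\mathfrak{m}\ltimes\mathfrak{m}M)=h_s(R)+h_s(M).$$ In particular, if $\dim(M)<\dim(R)$, then $$h_s(R\ltimes M)\leq h_s(\mathfrak{m}\ltimes\mathfrak{m}M)=h_s(R).$$ Here $h_s(R\ltimes M)$ and $h_s(\mathfrak{m}\ltimes\mathfrak{m}M)$ are taken over the ring $R\ltimes M$, and $h_s(R)$, $h_s(M)$ over $R$.
   Context: All rings are commutative, Noetherian, local, with identity. Idealization: for a ring $R$ and an $R$-module $M$, $R\ltimes M$ is the set of pairs $(r,m)$, $r\in R$, $m\in M$, with componentwise addition and multiplication $(r,m)(r',m')=(rr',rm'+r'm)$. If $(R,\mathfrak{m})$ is local and $M$ is finitely generated, then $R\ltimes M$ is local with maximal ideal $\mathfrak{m}\ltimes M$, has the same characteristic as $R$, and $\dim(R\ltimes M)=\dim R$. $h$-function: let $(A,\mathfrak{n})$ be a local ring of prime characteristic $p>0$ and dimension $d>0$, let $I,J$ be $\mathfrak{n}$-primary ideals, $N$ a finitely generated $A$-module, $s>0$ real. Put $$h_s(I,J;N)=\lim_{e\to\infty}\frac{\ell_A\big(N/(I^{\lceil sp^e\rceil}+J^{[p^e]})N\big)}{p^{ed}},\qquad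 d=\dim A,$$ where $\ell_A$ is length and $J^{[p^e]}$ is the ideal generated by the $p^e$-th powers of elements of $J$ (the limit is known to exist). Abbreviations: for an $\mathfrak{n}$-primary ideal $I$ of $A$, $h_s(I):=h_s(I,I;A)$; for a finitely generated $A$-module $N$ (including $N=A$), $h_s(N):=h_s(\mathfrak{n},\mathfrak{n};N)$. *)

(* Defs.v *)
From HB Require Import structures.
From mathcomp Require Import all_boot all_order all_algebra generic_quotient ring_quotient.
From mathcomp Require Import all_classical all_reals all_analysis.

Set Implicit Arguments.
Unset Strict Implicit.
Unset Printing Implicit Defensive.

Import Order.TTheory GRing.Theory Num.Theory.
Import numFieldNormedType.Exports.

Local Open Scope classical_set_scope.
Local Open Scope ring_scope.

Section Submodules.
Context {R : comNzRingType} {V : lmodType R}.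

Definition submodule (S : set V) : Prop :=
  [/\ S 0, (forall u v, S u -> S v -> S (u + v))
         & (forall (a : R) u, S u -> S (a *: u))].

Definition span (X : set V) : set V :=
  [set v | forall S, submodule S -> X `<=` S -> S v].

Lemma span_submodule (X : set V) : submodule (span X).
Proof.
split=> [S [] //|u v Xu Xv S Ssub XS|a u Xu S Ssub XS]; have [_ SD SZ] := Ssub.
  by apply: SD; [apply: Xu | apply: Xv].
by apply: SZ; apply: Xu.
Qed.

(* I N, as the submodule generated by the products a x. *)
Definition ideal_smul (I : set R) (N : set V) : set V :=
  span [set a *: x | a in I & x in N].

Definition annihilator : set R := [set a | forall x : V, a *: x = 0].

End Submodules.

Definition strict_chain (T : Type) (n : nat) (P : set (set T)) (C : nat -> set T) : Prop :=
  (forall i, (i <= n)%N -> P (C i)) /\ (forall i, (i < n)%N -> C i `<` C i.+1).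

Definition fin_gen (R : comNzRingType) (V : lmodType R) : Prop :=
  exists2 X : set V, finite_set X & span X = setT.

(* The greatest element of P; 0 when P is empty or unbounded. *)
Definition nat_max (P : set nat) : nat :=
  xget 0%N [set n | P n /\ forall k, P k -> (k <= n)%N].

(* The number of strict inclusions in a longest chain of submodules of V
   (0 for a module of infinite length). *)
Definition length (R : comNzRingType) (V : lmodType R) : nat :=
  nat_max [set n | exists C : nat -> set V, strict_chain n submodule C].

Section Quotient.
Context {R : comNzRingType} {V : lmodType R}.
Variable X : set V.

Definition span_pred : {pred V} := fun v => `[< span X v >].

Lemma span_pred_submod_closed : submod_closed span_pred.
Proof.
have [S0 SD SZ] := span_submodule X; split; first exact/asboolP.
by move=> a u v /asboolP Xu /asboolP Xv; apply/asboolP; apply: (SD (a *: u) v (SZ a u Xu) Xv).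
Qed.

HB.instance Definition _ :=
  GRing.isSubmodClosed.Build R V span_pred span_pred_submod_closed.

(* V / <X>; it is V / X when X is already a submodule. *)
Definition quotmod : Type := Quotient.quot span_pred.

HB.instance Definition _ := GRing.Zmodule.on quotmod.

Local Open Scope quotient_scope.

Definition quotmod_pi (v : V) : quotmod := \pi_(Quotient.quot span_pred) v.

Definition quotmod_scale (a : R) (x : quotmod) : quotmod :=
  quotmod_pi (a *: (repr (x : Quotient.quot span_pred))).

Lemma quotmod_piD u v : quotmod_pi (u + v) = quotmod_pi u + quotmod_pi v.
Proof. exact: (raddfD \pi_(Quotient.quot span_pred)). Qed.

Lemma quotmod_piP u v : reflect (quotmod_pi u = quotmod_pi v) (u - v \in span_pred).
Proof. by rewrite Quotient.idealrBE; apply: eqP. Qed.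

Lemma quotmod_piZ a v : quotmod_scale a (quotmod_pi v) = quotmod_pi (a *: v).
Proof.
apply/quotmod_piP; rewrite -scalerBr rpredZ //; apply/quotmod_piP.
by rewrite /quotmod_pi reprK.
Qed.

Lemma quotmod_pi_surj (x : quotmod) : exists v, x = quotmod_pi v.
Proof. by exists (repr (x : Quotient.quot span_pred)); rewrite /quotmod_pi reprK. Qed.

Lemma quotmod_scaleA a b x :
  quotmod_scale a (quotmod_scale b x) = quotmod_scale (a * b) x.
Proof. by have [v ->] := quotmod_pi_surj x; rewrite !quotmod_piZ scalerA. Qed.

Lemma quotmod_scale1 : left_id 1 quotmod_scale.
Proof. by move=> x; have [v ->] := quotmod_pi_surj x; rewrite quotmod_piZ scale1r. Qed.

Lemma quotmod_scaleDr : right_distributive quotmod_scale +%R.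
Proof.
move=> a x y; have [u ->] := quotmod_pi_surj x; have [v ->] := quotmod_pi_surj y.
by rewrite -quotmod_piD !quotmod_piZ scalerDr quotmod_piD.
Qed.

Lemma quotmod_scaleDl x : {morph quotmod_scale^~ x : a b / a + b}.
Proof. by move=> a b; have [v ->] := quotmod_pi_surj x; rewrite !quotmod_piZ scalerDl quotmod_piD. Qed.

HB.instance Definition _ := GRing.Zmodule_isLmodule.Build R quotmod
  quotmod_scaleA quotmod_scale1 quotmod_scaleDr quotmod_scaleDl.

End Quotient.
Arguments quotmod {R} V X.

Section Ideals.
Context {A : comNzRingType}.
Implicit Types I J P n : set A.

Definition ideal I : Prop := submodule (I : set A^o).

Definition ideal_gen (X : set A) : set A := span (X : set A^o).

Definition ideal_add I J : set A := [set a + b | a in I & b in J].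

Definition ideal_pow I (k : nat) : set A :=
  iter k (fun J => ideal_smul I (J : set A^o)) setT.

(* J^[q], for q a power of the characteristic. *)
Definition frobenius_pow J (q : nat) : set A := ideal_gen [set a ^+ q | a in J].

Definition prime_ideal P : Prop :=
  [/\ ideal P, ~ P 1 & forall a b, P (a * b) -> P a \/ P b].

Definition maximal_ideal n : Prop :=
  [/\ ideal n, ~ n 1 & forall I, ideal I -> n `<=` I -> I = n \/ I = setT].

End Ideals.

Definition noetherian (A : comNzRingType) : Prop :=
  forall I : set A, ideal I -> exists2 X : set A, finite_set X & ideal_gen X = I.

Definition local_ring (A : comNzRingType) (n : set A) : Prop :=
  maximal_ideal n /\ forall n', maximal_ideal n' -> n' = n.

(* As local Noetherian rings have finite dimension, nat_max is a genuine
   maximum for them and for their nonzero modules. *)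
Definition krull_dim (A : comNzRingType) : nat :=
  nat_max [set k | exists C : nat -> set A, strict_chain k prime_ideal C].

(* dim (A / Ann V); for V = 0 the value is 0, which stands for -oo: both are
   below every positive dimension. *)
Definition module_dim (A : comNzRingType) (V : lmodType A) : nat :=
  nat_max [set k | exists C : nat -> set A,
    strict_chain k (fun P : set A => prime_ideal P /\ annihilator (V := V) `<=` P) C].

Definition idealization (R : comNzRingType) (M : lmodType R) : Type := (R * M)%type.

Section Idealization.
Context {R : comNzRingType} {M : lmodType R}.
Implicit Types x y z : idealization M.

HB.instance Definition _ := GRing.Zmodule.on (idealization M).

Definition idealization_one : idealization M := (1, 0).

Definition idealization_mul x y : idealization M :=
  (x.1 * y.1, x.1 *: y.2 + y.1 *: x.2).

Lemma idealization_mulA : associative idealization_mul.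
Proof.
move=> x y z; congr (_, _); rewrite /= ?mulrA // !scalerDr !scalerA addrA.
by rewrite [z.1 * x.1]mulrC [z.1 * y.1]mulrC.
Qed.

Lemma idealization_mulC : commutative idealization_mul.
Proof. by move=> x y; congr (_, _); rewrite /= 1?mulrC 1?addrC. Qed.

Lemma idealization_mul1 : left_id idealization_one idealization_mul.
Proof.
by move=> [a u]; rewrite /idealization_mul /= mul1r scale1r scaler0 addr0.
Qed.

Lemma idealization_mulDl : left_distributive idealization_mul +%R.
Proof.
move=> x y z; congr (_, _) => /=; first by rewrite mulrDl.
by rewrite scalerDl scalerDr addrACA.
Qed.

Lemma idealization_one_neq0 : idealization_one != 0.
Proof. by apply/eqP => -[/eqP]; rewrite oner_eq0. Qed.

HB.instance Definition _ := GRing.Zmodule_isComNzRing.Build (idealization M)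
  idealization_mulA idealization_mulC idealization_mul1 idealization_mulDl
  idealization_one_neq0.

Definition idealization_set (I : set R) (N : set M) : set (idealization M) :=
  [set x | I x.1 /\ N x.2].

End Idealization.

Lemma local_ring_idealization (R : comNzRingType) (M : lmodType R) (m : set R) :
  local_ring m -> local_ring (idealization_set m [set: M]).
Proof.
have addE (x y : idealization M) : x + y = (x.1 + y.1, x.2 + y.2) by [].
have mulE (x y : idealization M) : x * y = (x.1 * y.1, x.1 *: y.2 + y.1 *: x.2).
  by [].
have sclE (x : idealization M) (y : (idealization M)^o) : x *: y = x * y by [].
pose zM (x : M) : idealization M := (0, x).
pose iR (a : R) : idealization M := (a, 0).
have dec (z : idealization M) : z = iR z.1 + zM z.2.
  by case: z => a x; rewrite addE /= addr0 add0r.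
have iRD a b : iR (a + b) = iR a + iR b by rewrite addE /= addr0.
have iRM a b : iR (a * b) = iR a * iR b by rewrite mulE /= !scaler0 addr0.
(* Ideals containing 0 x M are pulled back from R. *)
have pull (I : set (idealization M)) : ideal I -> (forall x, I (zM x)) ->
    ideal [set a | I (iR a)] /\ I = idealization_set [set a | I (iR a)] setT.
  move=> [I0 ID IZ] IM; split.
    split; [exact: I0 | by move=> u v /= Iu Iv; rewrite iRD; apply: ID |].
    by move=> a u /= Iu; rewrite /GRing.scale /= iRM; apply: (IZ (iR a)).
  apply/seteqP; split=> z; rewrite /idealization_set /=.
    move=> Iz; split => //.
    have -> : iR z.1 = z + (zM (- z.2)).
      by case: z {Iz} => a x; rewrite addE /= addr0 subrr.
    exact: ID.
  by case=> Iz _; rewrite (dec z); apply: ID.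
have push (I : set R) : ideal I -> ideal (idealization_set I [set: M]).
  move=> [I0 ID IZ]; split=> [|u v [Iu _] [Iv _]|a u [Iu _]]; split => //=.
    exact: ID.
  exact: (IZ a.1).
move=> [[mI m1 mmax] muniq]; split.
  split; [exact: push | by case |].
  move=> I Iid mI'; have [|I'id IE] := pull I Iid.
    by move=> x; apply: mI'; split => //; case: mI.
  have [|E|E] := mmax _ I'id.
  - by move=> a ma; apply: mI'; split.
  - by left; rewrite IE E.
  - by right; rewrite IE E; apply/seteqP; split.
move=> n [nid n1 nmax]; have [n0 nD nZ] := nid.
have nM x : n (zM x).
  pose I := [set z | exists2 u, n u & exists y, z = u + zM y].
  have Iid : ideal I.
    split=> [|u v [u' nu [y ->]] [v' nv [z ->]]|a u [u' nu [y ->]]].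
    - by exists 0 => //; exists 0; rewrite add0r.
    - exists (u' + v'); first exact: nD.
      by exists (y + z); rewrite addrACA; congr (_ + _); rewrite addE /= addr0.
    - exists (a * u'); first exact: (nZ a).
      exists (a.1 *: y); rewrite sclE mulrDr; congr (_ + _).
      by rewrite mulE /= mulr0 scale0r addr0.
  have nI : n `<=` I by move=> u nu; exists u => //; exists 0; rewrite addr0.
  have Ix : I (zM x) by exists 0 => //; exists x; rewrite add0r.
  have [<- //|IT] := nmax _ Iid nI.
  have [u nu [y]] : I 1 by rewrite IT.
  rewrite addE /= addr0 => -[u1 u2]; case: n1.
  have -> : 1 = ((1, - u.2) : idealization M) * u.
    by rewrite mulE /= -u1 mulr1 !scale1r subrr.
  exact: (nZ (1, - u.2)).
have [I'id IE] := pull n nid nM.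
rewrite IE; congr idealization_set; apply: muniq; split=> // J Jid IJ.
have [|E|E] := nmax _ (push _ Jid).
- by rewrite IE => z [/= Iz _]; split => //; apply: IJ.
- left; apply/seteqP; split => // a Ja; rewrite /= -E; split => //.
- right; apply/seteqP; split => // a _.
  by have [] : idealization_set J [set: M] (iR a) by rewrite E.
Qed.

Section HFunction.
Context {K : realType} {A : comNzRingType}.

Definition h_seq (p : nat) (s : K) (I J : set A) (N : lmodType A) : K^nat :=
  fun e =>
    (length (quotmod N (ideal_smul
       (ideal_add (ideal_pow I `|Num.ceil (s * (p ^ e)%:R)|%N)
                  (frobenius_pow J (p ^ e)%N)) setT)))%:R
    / (p ^ (e * krull_dim A))%:R.

(* lim returns a default value on divergent sequences, so h_fun is meaningful
   together with cvgn (h_seq p s I J N). *)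
Definition h_fun (p : nat) (s : K) (I J : set A) (N : lmodType A) : K :=
  limn (h_seq p s I J N).

Definition h_ideal (p : nat) (s : K) (I : set A) : K := h_fun p s I I A^o.

Definition h_module (p : nat) (s : K) (n : set A) (N : lmodType A) : K :=
  h_fun p s n n N.

End HFunction.

(* Main.v *)
(* Write n = m |x M and I = m |x mM.  By induction I^k = m^k |x m^k M, and since
   (a, x)^q = (a^q, q a^(q-1) x) with q = 0 in R for q > 1, also
   I^[q] = m^[q] |x m^[q] M.  So, with J = m^k + m^[q], I^k + I^[q] = J |x JM,
   and cutting at J |x M shows that its colength is l(R/J) + l(M/JM).  As prime ideals of R |x M contain 0 |x M, the
   dimensions of R and R |x M agree, hence h_s(I) = h_s(R) + h_s(M).  The
   inequality follows from the inclusion of I in n.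
   If r = dim M < d = dim R, prime avoidance gives x_1, ..., x_r in m such that
   Ann M + (x_1, ..., x_r) has finite colength c.  Then
   l(M/m^[q]M) <= g l(R/(Ann M + (x_1^q, ..., x_r^q))) <= g q^r c, where g is
   the number of generators of M; dividing by q^d gives h_s(M) = 0. *)
Require Import Defs.
From mathcomp Require Import all_boot all_order all_algebra.
From mathcomp Require Import all_classical all_reals all_analysis.

Set Implicit Arguments.
Unset Strict Implicit.
Unset Printing Implicit Defensive.

Import Order.TTheory GRing.Theory Num.Theory.
Import numFieldNormedType.Exports.

Local Open Scope classical_set_scope.
Local Open Scope ring_scope.

(* length, krull_dim and module_dim all unfold to nat_max of such a set.  Since
   nat_max is 0 on unbounded sets, lengths can only be compared under a bound
   chains_le. *)
Definition has_chain (T : Type) (P : set (set T)) : set nat :=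
  [set n | exists C : nat -> set T, strict_chain n P C].

Definition chains_le (T : Type) (P : set (set T)) (b : nat) : Prop :=
  forall n, has_chain P n -> (n <= b)%N.

Definition over (R : comNzRingType) (V : lmodType R) (X : set V) : set (set V) :=
  [set U | submodule U /\ X `<=` U].

Definition between (R : comNzRingType) (V : lmodType R) (X Y : set V) :
  set (set V) := [set U | [/\ submodule U, X `<=` U & U `<=` Y]].

(** A nonempty bounded set has a greatest element, so the default value of [xget] does not occur. *)
Lemma nat_maxP (S : set nat) b : S !=set0 -> (forall k, S k -> (k <= b)%N) ->
  S (nat_max S) /\ forall k, S k -> (k <= nat_max S)%N.
Proof.
move=> [k0 Sk0] Sb; apply: (xgetPex 0%N (P := [set n | S n /\ _])).
have ex : exists n, `[< S n >] by exists k0; apply/asboolP.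
have ub k : `[< S k >] -> (k <= b)%N by move/asboolP/Sb.
case: (ex_maxnP ex ub) => n /asboolP Sn nub; exists n; split=> // k Sk.
by apply: nub; apply/asboolP.
Qed.

(** A positive value cannot be the default 0, so it is a genuine maximum. *)
Lemma nat_max_ub (S : set nat) : (0 < nat_max S)%N ->
  forall k, S k -> (k <= nat_max S)%N.
Proof. by rewrite /nat_max; case: xgetP => // n -> [_ ubn] _. Qed.

(** * Strict chains of subsets *)

Section Chains.
Variable T : Type.
Implicit Types (P Q : set (set T)) (W : set T).

(** Equalities of lengths and of dimensions come from two such strictly increasing maps in opposite
    directions. *)
Lemma has_chain_map (T' : Type) P (Q : set (set T')) (f : set T -> set T') :
  (forall U, P U -> Q (f U)) ->
  (forall U W, P U -> P W -> U `<` W -> f U `<` f W) ->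
  has_chain P `<=` has_chain Q.
Proof.
move=> PQ fS n [C [PC SC]]; exists (f \o C); split=> i ni /=.
  exact: PQ (PC _ ni).
by apply: fS; [exact: PC (ltnW ni) | exact: PC | exact: SC].
Qed.

Lemma has_chain_sub P Q : P `<=` Q -> has_chain P `<=` has_chain Q.
Proof. by move=> PQ; apply: (has_chain_map (f := id)). Qed.

(** The bound [W] on the top term records where a further chain can be attached. *)
Definition chain_upto P W : set nat :=
  [set n | exists C : nat -> set T, strict_chain n P C /\ C n `<=` W].

Lemma chain_upto0 P W : P W -> chain_upto P W 0.
Proof. by move=> PW; exists (fun=> W); split=> //; split. Qed.

Lemma chain_upto_has P W : chain_upto P W `<=` has_chain P.
Proof. by move=> n [C [CP _]]; exists C. Qed.

Lemma chain_uptoW P U W n : U `<=` W -> chain_upto P U n -> chain_upto P W n.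
Proof. by move=> UW [C [CP CU]]; exists C; split=> //; apply: subset_trans UW. Qed.

(** The top [C n] is replaced by [D 0], which contains [W] and hence [C n]. The inclusion below it
    stays strict, and no step is lost even if [C n] and [D 0] coincide. *)
Lemma chain_upto_cat P Q W n k : (forall U, Q U -> W `<=` U) ->
  chain_upto P W n -> has_chain Q k ->
  has_chain (P `|` Q) (n + k).
Proof.
move=> QW [C [[PC SC] CW]] [D [QD SD]].
exists (fun i => if (i < n)%N then C i else D (i - n)%N); split=> i ik.
  case: ifP => ni; first by left; exact: PC (ltnW ni).
  by right; apply: QD; rewrite leq_subLR.
have [ni|ni] := ltnP i n; last first.
  by rewrite ltnNge (leqW ni) /= subSn //; apply: SD; rewrite ltn_subLR.
case: ifP => [Sni|/negbT]; first by apply: SC.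
rewrite -leqNgt => nSi; have nE : n = i.+1 by apply/eqP; rewrite eqn_leq nSi.
have [CS' NCS'] := SC i ni; have CD : C n `<=` D 0%N.
  by apply: subset_trans CW (QW _ (QD 0%N (leq0n _))).
rewrite -nE subnn; rewrite -nE in CS' NCS'; split; first exact: subset_trans CD.
by move=> DC; apply: NCS'; apply: subset_trans DC.
Qed.

Lemma chain_upto_rcons P U W n : P W -> U `<` W ->
  chain_upto P U n -> chain_upto P W n.+1.
Proof.
move=> PW [UW NUW] [C [[PC SC] CU]].
exists (fun i => if (i <= n)%N then C i else W); split; last by rewrite ltnn.
split=> i; first by move=> _; case: ifP => // /PC.
move=> ni; rewrite -ltnS ni; move: ni; rewrite ltnS leq_eqVlt => /predU1P[->|ni].
  2: by rewrite ni; apply: SC.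
rewrite ltnn; split; first exact: subset_trans UW.
by move=> WC; apply: NUW; apply: subset_trans CU.
Qed.

End Chains.

(** * Additivity of length in the lattice of submodules *)

Section SubmoduleLattice.
Context {R : comNzRingType} {V : lmodType R}.
Implicit Types (X Y U W : set V).

Definition addm U W : set V := [set u + w | u in U & w in W].

Lemma submoduleN U u : submodule U -> U u -> U (- u).
Proof. by move=> [_ _ UZ] Uu; rewrite -scaleN1r; apply: UZ. Qed.

Lemma submoduleB U u v : submodule U -> U u -> U v -> U (u - v).
Proof. by move=> Us Uu Uv; case: (Us) => _ UD _; apply: UD => //; apply: submoduleN. Qed.

Lemma addm_submodule U W : submodule U -> submodule W -> submodule (addm U W).
Proof.
move=> [U0 UD UZ] [W0 WD WZ]; split.
- by exists 0 => //; exists 0 => //; rewrite addr0.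
- move=> _ _ [u Uu [w Ww <-]] [u' Uu' [w' Ww' <-]].
  exists (u + u'); first exact: UD.
  by exists (w + w'); [exact: WD | rewrite addrACA].
- move=> a _ [u Uu [w Ww <-]]; exists (a *: u); first exact: UZ.
  by exists (a *: w); [exact: WZ | rewrite scalerDr].
Qed.

Lemma subset_addml U W : submodule W -> U `<=` addm U W.
Proof. by move=> [W0 _ _] u Uu; exists u => //; exists 0 => //; rewrite addr0. Qed.

Lemma subset_addmr U W : submodule U -> W `<=` addm U W.
Proof. by move=> [U0 _ _] w Ww; exists 0 => //; exists w => //; rewrite add0r. Qed.

Lemma addm_sub U W X : submodule X -> U `<=` X -> W `<=` X -> addm U W `<=` X.
Proof. by move=> [_ XD _] UX WX _ [u Uu [w Ww <-]]; apply: XD; auto. Qed.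

Lemma setI_submodule U W : submodule U -> submodule W -> submodule (U `&` W).
Proof.
move=> [U0 UD UZ] [W0 WD WZ]; split => //.
- by move=> u v [Uu Wu] [Uv Wv]; split; [exact: UD | exact: WD].
- by move=> a u [Uu Wu]; split; [exact: UZ | exact: WZ].
Qed.

(* If U < W then, by modularity, the intersections with Y or the sums with Y
   differ. *)
Lemma chain_split X Y n C : submodule Y -> X `<=` Y -> strict_chain n (over X) C ->
  exists a b, [/\ (n <= a + b)%N, chain_upto (between X Y) (C n `&` Y) a
                & chain_upto (over Y) (addm (C n) Y) b].
Proof.
move=> Ys XY; elim: n => [|n IH] [CP CS].
  have [C0s XC0] := CP 0%N isT.
  exists 0%N, 0%N; split=> //; apply: chain_upto0.
    split; [exact: setI_submodule | | exact: subIsetr].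
    by move=> x Xx; split; [exact: XC0 | exact: XY].
  by split; [exact: addm_submodule | exact: subset_addmr].
have [|a [b [nab Ha Hb]]] := IH; first (split => i ni).
- by apply: CP; apply: leqW.
- by apply: CS; apply: leqW.
have [Cns XCn] := CP n (leqnSn n); have [CSs XCS] := CP n.+1 (leqnn _).
have [CC NCC] := CS n (leqnn _).
have Pa : between X Y (C n.+1 `&` Y).
  split; [exact: setI_submodule | | exact: subIsetr].
  by move=> x Xx; split; [exact: XCS | exact: XY].
have Pb : over Y (addm (C n.+1) Y).
  by split; [exact: addm_submodule | exact: subset_addmr].
have CI : C n `&` Y `<=` C n.+1 `&` Y by apply: setSI.
have CA : addm (C n) Y `<=` addm (C n.+1) Y.
  by apply: addm_sub; [case: Pb| apply: subset_trans CC _; apply: subset_addml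
                      | case: Pb].
have [SI|NSI] := pselect (C n.+1 `&` Y `<=` C n `&` Y); last first.
  exists a.+1, b; split; [by rewrite addSn ltnS | exact: chain_upto_rcons Ha |].
  exact: chain_uptoW Hb.
exists a, b.+1; split; [by rewrite addnS ltnS | exact: chain_uptoW Ha |].
apply: chain_upto_rcons Hb => //; split=> // SA; apply: NCC => w Cw.
have [u Cu [y Yy uyw]] : addm (C n) Y w by apply: SA; apply: subset_addml.
have [Cy _] : (C n `&` Y) y.
  apply: SI; split=> //; have -> : y = w - u by rewrite -uyw addrC addrA addNr add0r.
  by apply: submoduleB => //; apply: CC.
by rewrite -uyw; have [_ D _] := Cns; apply: D.
Qed.

Lemma chains_le_split X Y a b : submodule Y -> X `<=` Y ->
  chains_le (between X Y) a -> chains_le (over Y) b -> chains_le (over X) (a + b).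
Proof.
move=> Ys XY Ha Hb n [C /(chain_split Ys XY)[a' [b' [nab Ha' Hb']]]].
apply: leq_trans nab _; apply: leq_add; [apply: Ha|apply: Hb].
  exact: chain_upto_has Ha'.
exact: chain_upto_has Hb'.
Qed.

(** Additivity of length: longest chains below and above [Y] are concatenated for one inequality,
    and a longest chain over [X] is cut by [chain_split] for the other. The bounds make all three
    maxima genuine. *)
Lemma nat_max_split X Y a b : submodule X -> submodule Y -> X `<=` Y ->
  chains_le (between X Y) a -> chains_le (over Y) b ->
  nat_max (has_chain (over X)) =
    (nat_max (has_chain (between X Y)) + nat_max (has_chain (over Y)))%N.
Proof.
move=> Xs Ys XY Ha Hb; have Hab := chains_le_split Ys XY Ha Hb.
have ne (P : set (set V)) W : P W -> has_chain P !=set0.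
  by move=> PW; exists 0%N; exists (fun=> W); split.
have [|Ca Ma] := nat_maxP _ Ha; first by apply: (ne _ X); split.
have [|Cb Mb] := nat_maxP _ Hb; first by apply: (ne _ Y); split.
have [|[C HC] Mc] := nat_maxP _ Hab; first by apply: (ne _ X); split.
apply/eqP; rewrite eqn_leq; apply/andP; split; last first.
  apply: Mc; apply: (has_chain_sub (P := between X Y `|` over Y)).
    by move=> U [[Us XU _]|[Us YU]]; split=> //; apply: subset_trans YU.
  apply: (chain_upto_cat (W := Y)) => //; first by move=> U [].
  by case: Ca => D HD; exists D; split => //; case: HD => /(_ _ (leqnn _))[].
have [a' [b' [nab Ha' Hb']]] := chain_split Ys XY HC.
apply: leq_trans nab _; apply: leq_add; [apply: Ma|apply: Mb].
  exact: chain_upto_has Ha'.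
exact: chain_upto_has Hb'.
Qed.

End SubmoduleLattice.

(** The bound on the larger set excludes the default 0 on the right-hand side. *)
Lemma nat_max_le (S S' : set nat) b : S !=set0 -> S `<=` S' ->
  (forall k, S' k -> (k <= b)%N) -> (nat_max S <= nat_max S')%N.
Proof.
move=> S0 SS' S'b; have [|Sm _] := nat_maxP S0 (b := b); first by move=> k /SS' /S'b.
have [|_ ub] := nat_maxP (S := S') (b := b) _ S'b; last exact/ub/SS'.
by case: S0 => x /SS'; exists x.
Qed.

(** * Length of a quotient module *)

Section QuotientLength.
Context {R : comNzRingType} {V : lmodType R}.
Variable X : set V.
Context (Xs : submodule X).

Lemma quotmod_pi_eq0 v : quotmod_pi X v = 0 <-> X v.
Proof.
have X0 : quotmod_pi X 0 = 0.
  by apply: (addIr (quotmod_pi X 0)); rewrite add0r -quotmod_piD addr0.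
rewrite -X0; split=> [/quotmod_piP|Xv]; rewrite ?subr0.
  by move=> /asboolP; apply.
by apply/quotmod_piP; rewrite subr0; apply/asboolP => S _; apply.
Qed.

(** Correspondence theorem: preimages and images under [quotmod_pi] preserve strict inclusions, the
    images because members of [over X] contain the kernel [X]. *)
Lemma length_quotmod : length (quotmod V X) = nat_max (has_chain (over X)).
Proof.
have piZ a v : a *: quotmod_pi X v = quotmod_pi X (a *: v) by apply: quotmod_piZ.
congr nat_max; apply/seteqP; split.
  apply: (has_chain_map (f := fun U : set (quotmod V X) => quotmod_pi X @^-1` U)).
    move=> U [U0 UD UZ]; split; last by move=> v /quotmod_pi_eq0; rewrite /preimage /= => ->.
    split; rewrite /preimage /=.
    - by have /quotmod_pi_eq0 -> : X 0 by case: Xs.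
    - by move=> u v Uu Uv; rewrite quotmod_piD; apply: UD.
    - by move=> a u Uu; rewrite -piZ; apply: UZ.
  move=> U W _ _ [UW NWU]; split=> [v /UW //|WU]; apply: NWU => x.
  by have [v ->] := quotmod_pi_surj x; apply: WU.
apply: (has_chain_map (f := fun U : set V => quotmod_pi X @` U)).
  move=> U [[U0 UD UZ] XU]; split.
  - by exists 0 => //; apply/quotmod_pi_eq0; case: Xs.
  - by move=> _ _ [u Uu <-] [v Uv <-]; exists (u + v); [apply: UD | apply: quotmod_piD].
  - by move=> a _ [u Uu <-]; exists (a *: u); [apply: UZ | rewrite -piZ].
move=> U W [Us XU] _ [UW NWU]; split; first exact: image_subset.
move=> WU; apply: NWU => w Ww; have [|u Uu /quotmod_piP] := WU (quotmod_pi X w).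
  by exists w.
move=> /asboolP /(_ X Xs) uw.
have -> : w = u - (u - w) by rewrite opprB addrC subrK.
by apply: submoduleB => //; apply: XU; apply: uw.
Qed.

End QuotientLength.

(** * Adjoining finitely many elements to a submodule *)

Section Adjoin.
Context {R : comNzRingType} {V : lmodType R}.
Implicit Types (U W : set V) (x : V).

(** The submodule U + Rx; folding over a list gives a filtration with cyclic quotients. *)
Definition adjoin U x : set V := addm U (range (fun r : R => r *: x)).

Lemma range_scale_submodule x : submodule (range (fun r : R => r *: x)).
Proof.
split; first by exists 0; rewrite ?scale0r.
  by move=> _ _ [a _ <-] [b _ <-]; exists (a + b); rewrite ?scalerDl.
by move=> a _ [b _ <-]; exists (a * b); rewrite ?scalerA.
Qed.

Lemma adjoin_submodule U x : submodule U -> submodule (adjoin U x).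
Proof. by move=> Us; apply: addm_submodule => //; apply: range_scale_submodule. Qed.

Lemma subset_adjoin U x : U `<=` adjoin U x.
Proof. by apply: subset_addml; apply: range_scale_submodule. Qed.

Lemma mem_adjoin U x : submodule U -> adjoin U x x.
Proof. by move=> Us; apply: subset_addmr => //; exists 1; rewrite ?scale1r. Qed.

Lemma adjoin_min U W x : submodule W -> U `<=` W -> W x -> adjoin U x `<=` W.
Proof.
move=> Ws UW Wx; apply: addm_sub => // _ [a _ <-].
by case: Ws => _ _; apply.
Qed.

Lemma adjoin_proper U x : submodule U -> ~ U x -> U `<` adjoin U x.
Proof.
move=> Us Ux; split; first exact: subset_adjoin.
by move=> /(_ x (mem_adjoin x Us)).
Qed.

Lemma foldl_adjoin_submodule s U : submodule U -> submodule (foldl adjoin U s).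
Proof. by elim: s U => //= x s IH U Us; apply/IH/adjoin_submodule. Qed.

Lemma subset_foldl_adjoin s U : U `<=` foldl adjoin U s.
Proof.
elim: s U => [|x s IH] U //=; apply: subset_trans (IH _); exact: subset_adjoin.
Qed.

Lemma mem_foldl_adjoin s U x : submodule U -> x \in s -> foldl adjoin U s x.
Proof.
elim: s U => //= y s IH U Us; rewrite inE => /predU1P[->|xs].
  by apply: subset_foldl_adjoin; apply: mem_adjoin.
by apply: IH => //; apply: adjoin_submodule.
Qed.

Lemma foldl_adjoin_min s U W : submodule W -> U `<=` W ->
  (forall x, x \in s -> W x) -> foldl adjoin U s `<=` W.
Proof.
move=> Ws; elim: s U => //= y s IH U UW sW; apply: IH => [|x xs].
  by apply: adjoin_min => //; apply: sW; rewrite mem_head.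
by apply: sW; rewrite inE xs orbT.
Qed.

End Adjoin.

(** * Prime ideals and systems of parameters *)

Section Noetherian.
Context {R : comNzRingType}.
Context (noethR : noetherian R).
Implicit Types (I J P Q : set R).

(** Otherwise choice yields a strictly ascending sequence of counterexamples. Its union is finitely
    generated, so one term contains all generators and the sequence stops there, a contradiction. *)
Lemma noetherian_ind (Pr : set R -> Prop) :
  (forall I, ideal I -> (forall J, ideal J -> I `<` J -> Pr J) -> Pr I) ->
  forall I, ideal I -> Pr I.
Proof.
move=> ind I0 I0s; apply: contrapT => nI0.
pose T := {I : set R | ideal I /\ ~ Pr I}.
have [f fP] : {f : T -> T & forall x, sval x `<` sval (f x)}.
  apply: (@choice T T (fun x y => sval x `<` sval y)) => -[I [Is nI]].
  apply: contrapT => nex; apply: (nI); apply: ind => // J Js IJ.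
  apply: contrapT => nJ; apply: nex; by exists (exist _ J (conj Js nJ)).
pose C n := sval (iter n f (exist _ I0 (conj I0s nI0))).
have CS n : C n `<` C n.+1 by apply: fP.
have Cs n : ideal (C n) by rewrite /C; case: (iter _ _ _) => I [].
have Cle n k : (n <= k)%N -> C n `<=` C k.
  move=> /subnK <-; elim: (k - n)%N => // j IH.
  by apply: subset_trans IH _; case: (CS (j + n)%N).
pose U := \bigcup_n C n.
have Us : ideal U.
  split; first by exists 0%N => //; case: (Cs 0%N).
    move=> u v [i _ Ci] [j _ Cj]; exists (maxn i j) => //.
    case: (Cs (maxn i j)) => _ D _; apply: D.
      exact: Cle (leq_maxl _ _) _ Ci.
    exact: Cle (leq_maxr _ _) _ Cj.
  by move=> a u [i _ Ci]; exists i => //; case: (Cs i) => _ _; apply.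
have [X /finite_seqP[s ->] XU] := noethR Us.
have sU x : x \in s -> U x by move=> xs; rewrite -XU => S _; apply.
have [N sN] : exists N, forall x, x \in s -> C N x.
  elim: s sU {XU} => [|x s IH] sU; first by exists 0%N.
  have [y ys|N sN] := IH; first by apply: sU; rewrite inE ys orbT.
  have [k _ Ck] := sU x (mem_head _ _); exists (maxn k N) => y.
  rewrite inE => /predU1P[->|ys]; first exact: Cle (leq_maxl _ _) _ Ck.
  exact: Cle (leq_maxr _ _) _ (sN _ ys).
have [_ NC] := CS N; apply: NC => x Cx; have : U x by exists N.+1.
by rewrite -XU; apply; [exact: Cs | exact: sN].
Qed.

Lemma not_prime_ideal I : ideal I -> ~ I 1 -> ~ prime_ideal I ->
  exists a b, [/\ I (a * b), ~ I a & ~ I b].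
Proof.
move=> Is I1 nP; apply: contrapT => nex; apply: nP; split=> // a b Iab.
have [|Ia] := pselect (I a); [by left | right].
by apply: contrapT => Ib; apply: nex; exists a, b.
Qed.

(* The finite list plays the role of the set of minimal primes over I. *)
Lemma finitely_many_primes_below I : ideal I -> exists s : seq (set R),
  (forall Q, Q \in s -> prime_ideal Q) /\
  (forall P, prime_ideal P -> I `<=` P -> exists2 Q, Q \in s & Q `<=` P) /\
  (forall Q, Q \in s -> I `<=` Q).
Proof.
move: I; apply: noetherian_ind => I Is IH.
have [I1|I1] := pselect (I 1).
  by exists [::]; split=> //; split=> // P [_ P1 _] IP; case: P1; apply: IP.
have [Ip|/(not_prime_ideal Is I1)[a [b [Iab Ia Ib]]]] := pselect (prime_ideal I).
  exists [:: I]; split; first by move=> Q; rewrite inE => /eqP ->.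
  split; last by move=> Q; rewrite inE => /eqP ->.
  by move=> P _ IP; exists I; rewrite ?inE.
have As c := @adjoin_submodule R R^o I c Is.
(* A prime over [I] contains ab, hence a or b, so it lies over one of the larger ideals (I, a) and
   (I, b). Their two lists are concatenated. *)
have [sa [pa [ca ia]]] := IH _ (As a) (adjoin_proper Is Ia).
have [sb [pb [cb ib]]] := IH _ (As b) (adjoin_proper Is Ib).
exists (sa ++ sb); split; last split.
- by move=> Q; rewrite mem_cat => /orP[/pa|/pb].
- move=> P Pp IP; have [Ps _ PM] := Pp.
  have [Pa|Pb] := PM a b (IP _ Iab).
    have [|Q Qs QP] := ca P Pp; first exact: (@adjoin_min R R^o).
    by exists Q; rewrite // mem_cat Qs.
  have [|Q Qs QP] := cb P Pp; first exact: (@adjoin_min R R^o).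
  by exists Q; rewrite // mem_cat Qs orbT.
- move=> Q; rewrite mem_cat => /orP[/ia|/ib] IQ; apply: subset_trans IQ;
  exact: (@subset_adjoin R R^o).
Qed.

Lemma prime_avoidance J (s : seq (set R)) : ideal J ->
  (forall Q, Q \in s -> prime_ideal Q) -> (forall Q, Q \in s -> ~ J `<=` Q) ->
  exists2 x, J x & forall Q, Q \in s -> ~ Q x.
Proof.
move=> Js; have [n] := ubnP (size s); elim: n s => // n IH [|Q t] /=.
  by move=> _ _ _; exists 0 => //; case: Js.
rewrite ltnS => tn tp tJ.
have tp' Q' : Q' \in t -> prime_ideal Q' by move=> Q't; apply: tp; rewrite inE Q't orbT.
have tJ' Q' : Q' \in t -> ~ J `<=` Q' by move=> Q't; apply: tJ; rewrite inE Q't orbT.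
(* Avoiding [Q] also avoids every prime inside [Q], so such a [Q1] is removed and the induction
   applies to the shorter list. *)
have [[Q1 Q1t Q1Q]|noQ1] := pselect (exists2 Q1, Q1 \in t & Q1 `<=` Q).
  have sub P : P \in Q :: rem Q1 t -> P \in Q :: t.
    by rewrite !inE => /predU1P[->|/mem_rem ->]; rewrite ?eqxx ?orbT.
  have [|P /sub|P /sub|x Jx xs] := IH (Q :: rem Q1 t).
  - by rewrite /= size_rem // prednK //; case: (t) Q1t.
  - exact: tp.
  - exact: tJ.
  have Qx : ~ Q x by apply: xs; rewrite mem_head.
  exists x => // P; rewrite inE => /predU1P[->//|].
  rewrite (perm_mem (perm_to_rem Q1t)) inE => /predU1P[->|Pt]; first by move/Q1Q.
  by apply: xs; rewrite inE Pt orbT.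
have [x Jx xt] := IH t tn tp' tJ'.
have [Qs _ QM] := tp Q (mem_head _ _).
have [Qx|Qx] := pselect (Q x); last first.
  by exists x => // P; rewrite inE => /predU1P[->|/xt].
(* Multiply an element of [J] outside [Q] by one element outside [Q] from each prime of [t];
   primality keeps the product outside [Q]. Then x + y is congruent to y modulo [Q] and to x modulo
   the primes of [t]. *)
have [y [Jy Qy yt]] : exists y, [/\ J y, ~ Q y & forall P, P \in t -> P y].
  have [z Jz Qz] : exists2 z, J z & ~ Q z.
    apply: contrapT => nz; apply: (tJ Q (mem_head _ _)) => z Jz.
    by apply: contrapT => Qz; apply: nz; exists z.
  have : forall P, P \in t -> ~ P `<=` Q by move=> P Pt PQ; apply: noQ1; exists P.
  elim: (t) tp' => [|P u IHu] up uQ; first by exists z.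
  have [|P' P'u|y [Jy Qy yu]] := IHu.
  - by move=> P' P'u; apply: up; rewrite inE P'u orbT.
  - by apply: uQ; rewrite inE P'u orbT.
  have [w Pw Qw] : exists2 w, P w & ~ Q w.
    apply: contrapT => nw; apply: (uQ P (mem_head _ _)) => w Pw.
    by apply: contrapT => Qw; apply: nw; exists w.
  exists (w * y); split.
  - by case: Js => _ _; apply.
  - by move=> /QM[].
  move=> P'; rewrite inE => /predU1P[->|P'u].
    by have [[_ _ PZ] _ _] := up P (mem_head _ _); rewrite mulrC; apply: PZ.
  have [|[_ _ PZ] _ _] := up P'; first by rewrite inE P'u orbT.
  by apply: PZ; apply: yu.
exists (x + y); first by case: Js => _ D _; apply: D.
move=> P; rewrite inE => /predU1P[->|Pt] Pxy.
  apply: Qy; have -> : y = x + y - x by rewrite addrC addKr.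
  exact: (@submoduleB R R^o).
apply: (xt P Pt); have -> : x = x + y - y by rewrite addrK.
have [Ps _ _] := tp' P Pt; apply: (@submoduleB R R^o) => //; exact: yt.
Qed.

Context {m : set R}.
Context (localR : local_ring m).

(** [localR] gives uniqueness only, so a maximal ideal above [I] is reached by Noetherian induction:
    a proper ideal with no larger proper ideal is maximal, hence equal to [m]. *)
Lemma proper_sub_maximal I : ideal I -> ~ I 1 -> I `<=` m.
Proof.
move: I; apply: noetherian_ind => I Is IH I1.
have [[J [Js IJ J1]]|noJ] := pselect (exists J, [/\ ideal J, I `<` J & ~ J 1]).
  by apply: subset_trans (IH J Js IJ J1); case: IJ.
rewrite (localR.2 I) //; split=> // J Js IJ.
have [JI|JI] := pselect (J `<=` I); first by left; apply/seteqP.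
right; have [J1|J1] := pselect (J 1); last by case: noJ; exists J.
apply/seteqP; split=> // a _; rewrite -[a]mulr1.
by case: Js => _ _; apply.
Qed.

Lemma prime_sub_maximal P : prime_ideal P -> P `<=` m.
Proof. by move=> [Ps P1 _]; apply: proper_sub_maximal. Qed.

Lemma prime_over_maximal P : prime_ideal P -> m `<=` P -> P = m.
Proof. by move=> /prime_sub_maximal Pm mP; apply/seteqP. Qed.

Lemma maximal_prime : prime_ideal m.
Proof.
have [[ms m1 mmax] _] := localR; split=> // a b mab.
have [|ma] := pselect (m a); [by left | right].
have [||E] := mmax _ (@adjoin_submodule R R^o m a ms).
- exact: (@subset_adjoin R R^o).
- by move=> E; case: ma; rewrite -E; apply: (@mem_adjoin R R^o).
have [u mu [_ [r _ <-]] ur1] : adjoin (V := R^o) m a 1 by rewrite E.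
rewrite -[b]mul1r -ur1 mulrDl; have [_ D Z] := ms; apply: D.
  by rewrite mulrC; apply: Z.
rewrite -mulrA; exact: Z.
Qed.

(** A parameter x is chosen outside the finitely many primes below all primes over [I], except [m].
    A chain of primes over (I, x) then extends downwards by one of these, so the bound drops by
    one. *)
Lemma system_of_parameters r I : ideal I ->
  chains_le [set P | prime_ideal P /\ I `<=` P] r ->
  exists xs : seq R, [/\ size xs = r, (forall x, x \in xs -> m x)
    & forall P, prime_ideal P -> foldl (@adjoin R R^o) I xs `<=` P -> P = m].
Proof.
elim: r I => [|r IH] I Is Ir.
  exists [::]; split=> // P Pp IP; apply: prime_over_maximal => //.
  (* If [P] were smaller than [m], the two would form a chain with one inclusion, against the bound
     0. *)
  apply: contrapT => mP; suff /Ir : has_chain [set P | prime_ideal P /\ I `<=` P] 1 by [].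
  exists (fun i => if i is 0%N then P else m); split=> [[|i] _|[|i]] //.
    split; first exact: maximal_prime.
    by apply: subset_trans IP _; apply: prime_sub_maximal.
  by move=> _; split => //; apply: prime_sub_maximal.
have [s [sp [sI Is0]]] := finitely_many_primes_below Is.
have [[ms _ _] _] := localR.
(* The ideal [m] is filtered out because no element of [m] avoids it. *)
have [||x mx xs] := @prime_avoidance m [seq Q <- s | Q != m] ms.
- by move=> Q; rewrite mem_filter => /andP[_ /sp].
- move=> Q; rewrite mem_filter => /andP[Qm /sp Qp] mQ.
  by case/eqP: Qm; apply: prime_over_maximal.
have [|| xs' [sz xs'm xs'P]] := IH (@adjoin R R^o I x).
- exact: adjoin_submodule.
- move=> n [C [CP CS]]; have [C0p IC0] := CP 0%N isT.
  have [|Q Qs QC0] := sI (C 0%N) C0p.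
    by apply: subset_trans IC0; apply: (@subset_adjoin R R^o).
  (* If [Q] is [m], the chain starts at [m] and has no inclusion at all. *)
  have [Qm|Qm] := eqVneq Q m.
    case: n CP CS => // n CP CS; have [_ []] := CS 0%N isT.
    rewrite (prime_over_maximal C0p); last by rewrite -Qm.
    by apply: prime_sub_maximal; case: (CP 1%N isT).
  rewrite -ltnS; apply: Ir; exists (fun i => if i is j.+1 then C j else Q).
  split=> [[_|i ni]|[_|i ni]] /=.
  - split; first exact: sp.
    exact: Is0.
  - have [Cp IC] := CP i ni; split=> //; apply: subset_trans IC.
    exact: (@subset_adjoin R R^o).
  - split=> // CQ; apply: (xs Q); first by rewrite mem_filter Qm.
    by apply: CQ; apply: IC0; apply: (@mem_adjoin R R^o).
  - exact: CS.
exists (x :: xs'); split=> //=; first by rewrite sz.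
by move=> y; rewrite inE => /predU1P[->|/xs'm].
Qed.

End Noetherian.

(** * Upper bounds for colengths *)

Lemma chains_le_over_sub (R : comNzRingType) (V : lmodType R) (X Y : set V) b :
  X `<=` Y -> chains_le (over X) b -> chains_le (over Y) b.
Proof.
move=> XY Xb n; move/(has_chain_sub (Q := over X)) => Yn; apply/Xb/Yn.
by move=> U [Us YU]; split=> //; apply: subset_trans YU.
Qed.

Lemma chains_le_overT (R : comNzRingType) (V : lmodType R) (X : set V) :
  X = setT -> chains_le (over X) 0.
Proof.
move=> -> [//|n] [C [CP CS]]; have [_ CT] := CP 0%N isT.
by have [_ []] := CS 0%N isT; apply: subset_trans CT.
Qed.

(* (U + Rx) / U is a quotient of R / J. *)
Lemma chains_le_adjoin (R : comNzRingType) (V : lmodType R) (J : set R)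
    (U : set V) (x : V) b :
  submodule U -> (forall a, J a -> U (a *: x)) ->
  chains_le (over (J : set R^o)) b -> chains_le (between U (adjoin U x)) b.
Proof.
move=> Us JU Jb n Un; apply: Jb; apply: has_chain_map Un.
  move=> W [[W0 WD WZ] UW _]; instantiate (1 := fun W => [set r | W (r *: x)]).
  split; last by move=> a /JU; apply: UW.
  split; rewrite /=.
  - by rewrite scale0r.
  - by move=> a c; rewrite scalerDl; apply: WD.
  - by move=> a c; rewrite -scalerA; apply: WZ.
move=> W W' [Ws UW _] [Ws' _ W'U] [WW' NWW']; split; first by move=> r /= /WW'.
move=> sub; apply: NWW' => w' W'w'; have [u Uu [_ [r _ <-] urw]] := W'U _ W'w'.
have [_ WD _] := Ws; rewrite -urw; apply: WD; first exact: UW.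
apply: sub => /=; have -> : r *: x = w' - u by rewrite -urw addrC addKr.
by apply: submoduleB => //; apply/WW'/UW.
Qed.

(** Adjoining the generators one at a time gives a filtration from [U] to [V] whose cyclic quotients
    are killed by [J], each of length at most [b]. *)
Lemma chains_le_fin_gen (R : comNzRingType) (V : lmodType R) (J : set R)
    (gens : seq V) (U : set V) b :
  submodule U -> (forall a x, J a -> U (a *: x)) ->
  foldl adjoin U gens = setT ->
  chains_le (over (J : set R^o)) b -> chains_le (over U) (size gens * b).
Proof.
move=> Us JU gT Jb; elim: gens U Us JU gT => [|x gens IH] U Us JU /= gT.
  exact: chains_le_overT.
rewrite mulSn; apply: (@chains_le_split _ _ _ (adjoin U x)).
- exact: adjoin_submodule.
- exact: subset_adjoin.
- by apply: chains_le_adjoin Jb => // a; apply: JU.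
- apply: IH => //; first exact: adjoin_submodule.
  by move=> a y /JU; move/(_ y); apply: subset_adjoin.
Qed.

Section Powers.
Context {R : comNzRingType}.
Implicit Types (I J : set R).
Local Notation adjoin := (@adjoin R R^o).

(* The successive quotients of the filtration by the ideals (I, x^j) are
   quotients of R / (I, x). *)
Lemma chains_le_adjoinX I x c q : ideal I ->
  chains_le (over (adjoin I x)) c -> chains_le (over (adjoin I (x ^+ q))) (q * c).
Proof.
move=> Is Ic; elim: q => [|q IH].
  (* For q = 0 the adjoined element is 1, so the ideal is the whole ring. *)
  apply: chains_le_overT; apply/seteqP; split=> // a _.
  exists 0; first by case: Is.
  by exists a; [exists a; rewrite // expr0 /GRing.scale /= mulr1 | rewrite add0r].
have As y := @adjoin_submodule R R^o I y Is.
(* The intermediate ideal is (I, x^q), written with the extra generator x^(q+1) so that it has the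
   form required by [chains_le_adjoin]. *)
rewrite mulSn; apply: (@chains_le_split _ _ _ (adjoin (adjoin I (x ^+ q.+1)) (x ^+ q))).
- exact: (@adjoin_submodule R R^o).
- exact: (@subset_adjoin R R^o).
- apply: (@chains_le_adjoin _ R^o (adjoin I x)) => // _ [u Iu [_ [r _ <-] <-]].
  exists (x ^+ q *: (u : R^o)); first by case: Is => _ _; apply.
  exists (r *: (x ^+ q.+1 : R^o)); first by exists r.
  by rewrite /GRing.scale /= mulrDl exprS mulrA [u * _]mulrC.
- apply: chains_le_over_sub IH; apply: (@adjoin_min R R^o).
  + exact: (@adjoin_submodule R R^o).
  + by apply: subset_trans (@subset_adjoin R R^o _ _); apply: (@subset_adjoin R R^o).
  + exact: (@mem_adjoin R R^o).
Qed.

(** One element is replaced by its power at a time, at the cost of a factor q. The order of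
    adjunction is exchanged so that the ideal generated by [I] and the other elements serves as base
    for [chains_le_adjoinX]. *)
Lemma chains_le_foldl_adjoinX (xs : seq R) I c q : ideal I ->
  chains_le (over (foldl adjoin I xs)) c ->
  chains_le (over (foldl adjoin I [seq x ^+ q | x <- xs])) (q ^ size xs * c).
Proof.
elim: xs I c => [|x xs IH] I c Is /= Ic; first by rewrite mul1n.
have As y J (Js : ideal J) := @adjoin_submodule R R^o J y Js.
have Fs s J (Js : ideal J) := @foldl_adjoin_submodule R R^o s J Js.
rewrite expnSr -mulnA; apply: IH; first exact: As.
apply: (@chains_le_over_sub _ _ (adjoin (foldl adjoin I xs) (x ^+ q))).
  apply: (@adjoin_min R R^o); first exact/Fs/As.
    apply: (@foldl_adjoin_min R R^o); first exact/Fs/As.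
      apply: subset_trans (@subset_foldl_adjoin R R^o _ _).
      exact: (@subset_adjoin R R^o).
    by move=> y ys; apply: (@mem_foldl_adjoin R R^o) => //; apply: As.
  by apply: (@subset_foldl_adjoin R R^o); apply: (@mem_adjoin R R^o).
apply: chains_le_adjoinX; first exact: Fs.
apply: chains_le_over_sub Ic; apply: (@foldl_adjoin_min R R^o).
- exact/As/Fs.
- apply: (@adjoin_min R R^o); first exact/As/Fs.
    apply: subset_trans (@subset_adjoin R R^o _ _).
    exact: (@subset_foldl_adjoin R R^o).
  by apply: (@mem_adjoin R R^o); apply: Fs.
- move=> y ys; apply: (@subset_adjoin R R^o).
  exact: (@mem_foldl_adjoin R R^o).
Qed.

(* Noetherian induction: if ab is in I but a, b are not, then (I, a) / I is
   R / (I : a), and both (I, a) and (I : a) are strictly larger than I. *)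
Lemma finite_colength (m : set R) (noethR : noetherian R) (localR : local_ring m) I :
  ideal I -> (forall P, prime_ideal P -> I `<=` P -> P = m) ->
  exists b, chains_le (over (I : set R^o)) b.
Proof.
move: I; apply: (noetherian_ind noethR) => I Is IH Im.
have [I1|I1] := pselect (I 1).
  exists 0%N; apply: chains_le_overT; apply/seteqP; split=> // a _.
  by rewrite -[a]mulr1; case: Is => _ _; apply.
have [Ip|/(not_prime_ideal Is I1)[a [b [Iab Ia Ib]]]] := pselect (prime_ideal I).
  (* Here [I] is [m], and R/m has length one: in a chain with two inclusions, [C 1] would be [m] or
     [R], and either choice makes one inclusion fail to be strict. *)
  exists 1%N => -[//|[//|n]] [C [CP CS]]; exfalso.
  have mI := Im I Ip (@subset_refl _ I).
  have [[_ _ mmax] _] := localR; rewrite -mI in mmax.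
  have [Cs IC] := CP 1%N isT; have [C0s IC0] := CP 0%N isT.
  have [C01 nC01] := CS 0%N isT; have [C12 nC12] := CS 1%N isT.
  have [E|E] := mmax _ Cs IC; first by apply: nC01; rewrite E.
  by apply: nC12; rewrite E.
have As c := @adjoin_submodule R R^o I c Is.
have up J : I `<` J -> forall P, prime_ideal P -> J `<=` P -> P = m.
  by move=> [IJ _] P Pp JP; apply: Im => //; apply: subset_trans JP.
pose J := [set r | I (r * a)].
have Js : ideal J.
  split; rewrite /J /=; first by rewrite mul0r; case: Is.
    by move=> u v Iu Iv; rewrite mulrDl; case: Is => _ D _; apply: D.
  by move=> c u Iu; rewrite -mulrA; case: Is => _ _; apply.
have IJ : I `<` J.
  split; first by move=> u Iu; rewrite /J /= mulrC; case: Is => _ _; apply.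
  by move=> JI; apply: Ib; apply: JI; rewrite /J /= mulrC.
have [c1 Hc1] := IH _ Js IJ (up _ IJ).
have [c2 Hc2] := IH _ (As a) (adjoin_proper Is Ia) (up _ (adjoin_proper Is Ia)).
exists (c1 + c2)%N; apply: (@chains_le_split _ _ _ (adjoin I a)) => //.
  exact: (@subset_adjoin R R^o).
exact: (@chains_le_adjoin _ R^o J).
Qed.

End Powers.

(** * Products, powers and Frobenius powers of ideals *)

Lemma sub_span (R : comNzRingType) (V : lmodType R) (X : set V) : X `<=` Defs.span X.
Proof. by move=> x Xx S _; apply. Qed.

Lemma span_min (R : comNzRingType) (V : lmodType R) (X S : set V) :
  submodule S -> X `<=` S -> Defs.span X `<=` S.
Proof. by move=> Ss XS v; apply. Qed.

Section IdealSmul.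
Context {R : comNzRingType} {V : lmodType R}.
Implicit Types (I J K : set R) (N : set V).

Lemma ideal_smul_submodule I N : submodule (ideal_smul I N).
Proof. exact: span_submodule. Qed.

Lemma mem_ideal_smul I N a x : I a -> N x -> ideal_smul I N (a *: x).
Proof. by move=> Ia Nx; apply: sub_span; exists a => //; exists x. Qed.

Lemma ideal_smul_min I N S : submodule S -> (forall a x, I a -> N x -> S (a *: x)) ->
  ideal_smul I N `<=` S.
Proof. by move=> Ss INS; apply: span_min => // _ [a Ia [x Nx <-]]; apply: INS. Qed.

Lemma ideal_smul_sub I J N : I `<=` J -> ideal_smul I N `<=` ideal_smul J N.
Proof.
move=> IJ; apply: ideal_smul_min; first exact: ideal_smul_submodule.
by move=> a x /IJ; apply: mem_ideal_smul.
Qed.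

Lemma scale_ideal_smul J K N a x : (forall b, J b -> K (a * b)) ->
  ideal_smul J N x -> ideal_smul K N (a *: x).
Proof.
move=> JK; move: x; have [K0 KD KZ] := ideal_smul_submodule K N.
apply: (ideal_smul_min (S := [set x | ideal_smul K N (a *: x)])).
  split=> [|u v Ku Kv|c u Ku] /=; first by rewrite scaler0.
    by rewrite scalerDr; apply: KD.
  by rewrite scalerA mulrC -scalerA; apply: KZ.
by move=> b x /JK Kab Nx /=; rewrite scalerA; apply: mem_ideal_smul.
Qed.

End IdealSmul.

Section IdealOps.
Context {A : comNzRingType}.
Implicit Types I J L P : set A.

Lemma idealD I a b : ideal I -> I a -> I b -> I (a + b).
Proof. by move=> [_ + _]; apply. Qed.

Lemma idealMl I a b : ideal I -> I b -> I (a * b).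
Proof. by move=> [_ _ +]; apply. Qed.

Lemma ideal_smul_regular I : ideal I -> ideal_smul I [set: A^o] = I.
Proof.
move=> Is; apply/seteqP; split.
  apply: ideal_smul_min => // a x Ia _; rewrite /GRing.scale /= mulrC.
  exact: idealMl.
move=> a Ia; rewrite -[a]mulr1; exact: (@mem_ideal_smul A A^o).
Qed.

Lemma ideal_pow_ideal I k : ideal (ideal_pow I k).
Proof. by case: k => [|k]; [split | apply: ideal_smul_submodule]. Qed.

Lemma frobenius_pow_ideal I q : ideal (frobenius_pow I q).
Proof. exact: span_submodule. Qed.

Lemma ideal_add_ideal I J : ideal I -> ideal J -> ideal (ideal_add I J).
Proof. exact: (@addm_submodule A A^o). Qed.

Lemma ideal_add_sub I I' J J' : I `<=` I' -> J `<=` J' ->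
  ideal_add I J `<=` ideal_add I' J'.
Proof. by move=> II' JJ' _ [a /II' Ia [b /JJ' Jb <-]]; exists a => //; exists b. Qed.

Lemma ideal_pow_sub I J k : I `<=` J -> ideal_pow I k `<=` ideal_pow J k.
Proof.
move=> IJ; elim: k => //= k IH; apply: (@ideal_smul_min A A^o).
  exact: ideal_smul_submodule.
by move=> a x /IJ Ja /IH Jx; apply: (@mem_ideal_smul A A^o).
Qed.

Lemma mem_frobenius_pow I q a : I a -> frobenius_pow I q (a ^+ q).
Proof. by move=> Ia; apply: (@sub_span A A^o); exists a. Qed.

Lemma frobenius_pow_min I q L : ideal L -> (forall a, I a -> L (a ^+ q)) ->
  frobenius_pow I q `<=` L.
Proof. by move=> Ls IL; apply: (@span_min A A^o) => // _ [a Ia <-]; apply: IL. Qed.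

Lemma frobenius_pow_sub I J q : I `<=` J -> frobenius_pow I q `<=` frobenius_pow J q.
Proof.
move=> IJ; apply: frobenius_pow_min; first exact: frobenius_pow_ideal.
by move=> a /IJ; apply: mem_frobenius_pow.
Qed.

Lemma prime_idealX P a n : prime_ideal P -> P (a ^+ n) -> P a.
Proof.
move=> [_ P1 PM]; elim: n => [|n IH]; first by rewrite expr0.
by rewrite exprS => /PM[].
Qed.

End IdealOps.

(** * Ideals, dimension and lengths in the idealization *)

Section Idealization.
Context {R : comNzRingType} {M : lmodType R}.
Local Notation A := (idealization M).
Implicit Types (I J P : set R) (N : set M) (L Q : set A).

(** For an ideal [I], this is the extension of [I] along the ring map sending a to (a, 0). *)
Definition ideal_idealize I : set A :=
  idealization_set I (ideal_smul I [set: M]).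

Lemma idealizationD (z w : A) : z + w = (z.1 + w.1, z.2 + w.2) :> A.
Proof. by []. Qed.

Lemma idealizationM (z w : A) : z * w = (z.1 * w.1, z.1 *: w.2 + w.1 *: z.2) :> A.
Proof. by []. Qed.

Lemma idealization_split (z : A) : z = ((z.1, 0) : A) + ((0, z.2) : A).
Proof. by rewrite idealizationD /= addr0 add0r; case: z. Qed.

(** Elements (0, x) multiply to zero, so the binomial expansion stops at first order. For n = 0 the
    truncated [n.-1] is harmless, its coefficient being 0. *)
Lemma idealizationX (z : A) n :
  z ^+ n = (z.1 ^+ n, (n%:R * z.1 ^+ n.-1) *: z.2) :> A.
Proof.
elim: n => [|n IH]; first by rewrite !expr0 mulr0n mul0r scale0r.
rewrite exprS IH idealizationM /= exprS scalerA -scalerDl; congr (_, _ *: _).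
case: n {IH} => [|n]; first by rewrite mul0r mulr0 add0r mul1r.
by rewrite /= mulrCA -exprS -[in RHS]addn1 natrD mulrDl mul1r.
Qed.

Lemma idealization_set_ideal I N : ideal I -> submodule N ->
  (forall a x, I a -> N (a *: x)) -> ideal (idealization_set I N).
Proof.
move=> Is Ns IN; have [I0 ID IZ] := Is; have [N0 ND NZ] := Ns.
split; first by split.
  by move=> u v [Iu Nu] [Iv Nv]; split; [apply: ID | apply: ND].
move=> a u [Iu Nu]; split; first exact: (IZ a.1).
by apply: ND; [apply: NZ | apply: IN].
Qed.

Lemma ideal_idealize_ideal I : ideal I -> ideal (ideal_idealize I).
Proof.
move=> Is; apply: idealization_set_ideal => //; first exact: ideal_smul_submodule.
by move=> a x Ia; apply: mem_ideal_smul.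
Qed.

Lemma comap_inl_ideal L : ideal L -> ideal [set a | L ((a, 0) : A)].
Proof.
move=> Ls; split=> [|a b La Lb|a b Lb] /=; first by case: Ls.
  have -> : (a + b, 0) = ((a, 0) : A) + ((b, 0) : A) by rewrite idealizationD /= addr0.
  exact: idealD.
have -> : (a *: (b : R^o), 0) = ((a, 0) : A) * ((b, 0) : A).
  by rewrite idealizationM /= !scaler0 addr0.
exact: idealMl.
Qed.

Lemma comap_inr_submodule L : ideal L -> submodule [set x | L ((0, x) : A)].
Proof.
move=> Ls; split=> [|x y Lx Ly|a x Lx] /=; first by case: Ls.
  have -> : (0, x + y) = ((0, x) : A) + ((0, y) : A) by rewrite idealizationD /= addr0.
  exact: idealD.
have -> : (0, a *: x) = ((a, 0) : A) * ((0, x) : A).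
  by rewrite idealizationM /= mulr0 scale0r addr0.
exact: idealMl.
Qed.

Lemma comap_inr_smul L a x : ideal L -> L ((a, 0) : A) -> L ((0, a *: x) : A).
Proof.
move=> Ls La; have -> : (0, a *: x) = ((0, x) : A) * ((a, 0) : A).
  by rewrite idealizationM /= mul0r scaler0 add0r.
exact: idealMl.
Qed.

(** The elements (a, 0) with a in [J] generate, since (0, ax) = (0, x)(a, 0). *)
Lemma ideal_idealize_min J L : ideal L -> (forall a, J a -> L ((a, 0) : A)) ->
  ideal_idealize J `<=` L.
Proof.
move=> Ls JL z [Jz1 Jz2]; rewrite (idealization_split z); apply: idealD => //.
  exact: JL.
move: z.2 Jz2; apply: (ideal_smul_min (S := [set x | L ((0, x) : A)])).
  exact: comap_inr_submodule.
by move=> a x /JL La _; apply: comap_inr_smul.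
Qed.

Lemma mem_ideal_idealize_inl J a : J a -> ideal_idealize J ((a, 0) : A).
Proof. by move=> Ja; split=> //=; case: (ideal_smul_submodule J [set: M]). Qed.

Lemma ideal_pow_idealize I k :
  ideal_pow (ideal_idealize I) k = ideal_idealize (ideal_pow I k).
Proof.
elim: k => [|k IH].
  apply/seteqP; split=> // z _; split=> //; rewrite -[z.2]scale1r.
  exact: mem_ideal_smul.
rewrite [LHS]/= -/(ideal_pow _ k) IH; apply/seteqP; split.
  apply: (@ideal_smul_min A A^o); first exact/ideal_idealize_ideal/ideal_pow_ideal.
  move=> a x [Ia1 Ia2] [Ix1 Ix2]; split; first exact: (@mem_ideal_smul R R^o).
  have [_ D _] := ideal_smul_submodule (ideal_pow I k.+1) [set: M]; apply: D.
    by apply: scale_ideal_smul Ix2 => b Ib; apply: (@mem_ideal_smul R R^o).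
  apply: scale_ideal_smul Ia2 => b Ib; rewrite mulrC.
  exact: (@mem_ideal_smul R R^o).
pose L : set A := ideal_smul (ideal_idealize I) (ideal_idealize (ideal_pow I k) : set A^o).
have Ls : ideal L by apply: ideal_smul_submodule.
have LM a b : ideal_idealize I a -> ideal_idealize (ideal_pow I k) b -> L (a * b).
  exact: (@mem_ideal_smul A A^o).
apply: (ideal_idealize_min (L := L)) => //.
apply: (ideal_smul_min (S := [set a | L ((a, 0) : A)] : set R^o)).
  exact: comap_inl_ideal.
move=> a b Ia Ib /=.
have -> : (a *: (b : R^o), 0) = ((a, 0) : A) * ((b, 0) : A).
  by rewrite [RHS]idealizationM /= !scaler0 addr0.
by apply: LM; apply: mem_ideal_idealize_inl.
Qed.

Lemma frobenius_pow_idealize p I e : p \in [pchar R] ->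
  frobenius_pow (ideal_idealize I) (p ^ e) = ideal_idealize (frobenius_pow I (p ^ e)).
Proof.
move=> charp; apply/seteqP; split.
  apply: frobenius_pow_min; first exact/ideal_idealize_ideal/frobenius_pow_ideal.
  move=> z [Iz1 Iz2]; rewrite idealizationX; split; first exact: mem_frobenius_pow.
  (* For e = 0 the exponent is 1 and the coefficient does not vanish; the second component then lies
     in IM, which is inside I^[1]M. *)
  rewrite /=; case: e => [|e].
    rewrite expn0 /= expr0 mulr1 scale1r; apply: ideal_smul_sub Iz2.
    by move=> a Ia; rewrite -[a]expr1; apply: mem_frobenius_pow.
  rewrite expnS natrM (pcharf0 charp) !mul0r scale0r.
  by case: (ideal_smul_submodule (frobenius_pow I (p * p ^ e)) [set: M]).
apply: ideal_idealize_min; first exact: frobenius_pow_ideal.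
apply: frobenius_pow_min; first exact/comap_inl_ideal/frobenius_pow_ideal.
move=> a Ia; rewrite /=; have -> : (a ^+ (p ^ e), 0) = ((a, 0) : A) ^+ (p ^ e).
  by rewrite idealizationX /= scaler0.
by apply: mem_frobenius_pow; apply: mem_ideal_idealize_inl.
Qed.

Lemma ideal_add_idealize I J : ideal I -> ideal J ->
  ideal_add (ideal_idealize I) (ideal_idealize J) = ideal_idealize (ideal_add I J).
Proof.
move=> Is Js; have IJs := ideal_add_ideal Is Js; apply/seteqP; split.
  have sub (K L : set R) : ideal L -> K `<=` L -> ideal_idealize K `<=` ideal_idealize L.
    move=> Ls KL; apply: ideal_idealize_min; first exact: ideal_idealize_ideal.
    by move=> a /KL; apply: mem_ideal_idealize_inl.
  apply: (@addm_sub A A^o); first exact: ideal_idealize_ideal.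
    by apply: sub => //; apply: (@subset_addml R R^o).
  by apply: sub => //; apply: (@subset_addmr R R^o).
apply: ideal_idealize_min.
  by apply: ideal_add_ideal; apply: ideal_idealize_ideal.
move=> _ [a Ia [b Jb <-]]; exists (a, 0); first exact: mem_ideal_idealize_inl.
exists (b, 0); first exact: mem_ideal_idealize_inl.
by rewrite idealizationD /= addr0.
Qed.

Lemma prime_ideal_inr Q x : prime_ideal Q -> Q ((0, x) : A).
Proof.
move=> [[Q0 _ _] _ QM]; suff /QM[] : Q (((0, x) : A) * ((0, x) : A)) by [].
by rewrite idealizationM /= mul0r scale0r addr0.
Qed.

Lemma krull_dim_idealization : krull_dim A = krull_dim R.
Proof.
congr nat_max; apply/seteqP; split.
  apply: (has_chain_map (f := fun Q => [set a | Q ((a, 0) : A)])).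
    move=> Q [Qs Q1 QM]; split; [exact: comap_inl_ideal | exact: Q1 |].
    move=> a b /= Qab; apply: QM; rewrite idealizationM /=.
    by rewrite !scaler0 addr0.
  move=> Q Q' Qp Qp' [QQ' NQQ']; split; first by move=> a /QQ'.
  move=> sub; apply: NQQ' => z Q'z; have [Qs _ _] := Qp; have [Q's _ _] := Qp'.
  rewrite (idealization_split z); apply: idealD => //; last exact: prime_ideal_inr.
  apply: sub => /=; have -> : (z.1, 0) = z + ((0, - z.2) : A).
    by rewrite idealizationD /= addr0 subrr.
  by apply: idealD => //; apply: prime_ideal_inr.
apply: (has_chain_map (f := fun P => idealization_set P [set: M])).
  move=> P [Ps P1 PM]; split; [exact: idealization_set_ideal | by case|].
  by move=> z w [/PM[?|?] _]; [left|right].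
move=> P P' _ _ [PP' NPP']; split; first by move=> z [/PP'].
by move=> sub; apply: NPP' => a Pa; have [] := sub (a, 0) (conj Pa Logic.I).
Qed.

(** Lattice form of the isomorphism of (R |x M)/(J |x M) with R/J: an ideal over J |x M contains 0
    |x M and is determined by its trace on [R]. *)
Lemma has_chain_over_idealize J : ideal J ->
  has_chain (over (idealization_set J [set: M] : set A^o)) =
  has_chain (over (J : set R^o)).
Proof.
move=> Js; apply/seteqP; split.
  apply: (has_chain_map (f := fun L : set A => [set a | L ((a, 0) : A)])).
    by move=> L [Ls JL]; split; [exact: comap_inl_ideal | move=> a Ja; exact: JL].
  move=> L L' [Ls JL] [L's JL'] [LL' NLL']; split; first by move=> a /LL'.
  move=> sub; apply: NLL' => z L'z; have J0 : J 0 by case: Js.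
  rewrite (idealization_split z); apply: (idealD Ls); last exact: JL.
  apply: sub => /=; have -> : (z.1, 0) = z + ((0, - z.2) : A).
    by rewrite idealizationD /= addr0 subrr.
  by apply: (idealD L's) => //; apply: JL'.
apply: (has_chain_map (f := fun I : set R => idealization_set I [set: M])).
  move=> I [Is JI]; split; first exact: idealization_set_ideal.
  by move=> z [/JI].
move=> P P' _ _ [PP' NPP']; split; first by move=> z [/PP'].
by move=> sub; apply: NPP' => a Pa; have [] := sub (a, 0) (conj Pa Logic.I).
Qed.

(** Lattice form of the isomorphism of (J |x M)/(J |x JM) with M/JM: an ideal in between contains
    all (a, 0) with a in [J] and is determined by its trace on [M]. *)
Lemma has_chain_between_idealize J : ideal J ->
  has_chain (between (ideal_idealize J : set A^o) (idealization_set J [set: M])) =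
  has_chain (over (ideal_smul J [set: M])).
Proof.
move=> Js; apply/seteqP; split.
  apply: (has_chain_map (f := fun L : set A => [set x | L ((0, x) : A)])).
    move=> L [Ls JL LJ]; split; first exact: comap_inr_submodule.
    by move=> x Jx; apply: JL; split=> //; case: Js.
  move=> L L' [Ls JL LJ] [L's JL' LJ'] [LL' NLL']; split; first by move=> a /LL'.
  move=> sub; apply: NLL' => z L'z; have [Jz _] := LJ' _ L'z.
  rewrite (idealization_split z); apply: (idealD Ls).
    by apply: JL; apply: mem_ideal_idealize_inl.
  apply: sub => /=; have -> : (0, z.2) = z + ((- z.1, 0) : A).
    by rewrite idealizationD /= addr0 subrr.
  apply: (idealD L's) => //; apply/JL'/mem_ideal_idealize_inl.
  exact: (@submoduleN R R^o).
apply: (has_chain_map (f := fun N => idealization_set J N)).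
  move=> N [Ns JN]; split; last by move=> z [].
    by apply: idealization_set_ideal => // a x Ja; apply: JN; apply: mem_ideal_smul.
  by move=> z [Jz /JN].
move=> N N' _ _ [NN' NNN']; split; first by move=> z [? /NN'].
have J0 : J 0 by case: Js.
by move=> sub; apply: NNN' => x Nx; have [] := sub (0, x) (conj J0 Nx).
Qed.

Lemma ideal_idealize_subT J : ideal_idealize J `<=` idealization_set J [set: M].
Proof. by move=> z []. Qed.

Lemma chains_le_idealize J b c : ideal J -> chains_le (over (J : set R^o)) b ->
  chains_le (over (ideal_smul J [set: M])) c ->
  chains_le (over (ideal_idealize J : set A^o)) (c + b).
Proof.
move=> Js Jb JMc; apply: (@chains_le_split _ A^o _ (idealization_set J [set: M])).
- exact: idealization_set_ideal.
- exact: ideal_idealize_subT.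
- by rewrite /chains_le has_chain_between_idealize.
- by rewrite /chains_le has_chain_over_idealize.
Qed.

Lemma length_idealize J b c : ideal J -> chains_le (over (J : set R^o)) b ->
  chains_le (over (ideal_smul J [set: M])) c ->
  length (quotmod A^o (ideal_idealize J)) =
    (length (quotmod R^o J) + length (quotmod M (ideal_smul J [set: M])))%N.
Proof.
move=> Js Jb JMc; rewrite !length_quotmod //; last exact: ideal_idealize_ideal.
  rewrite (@nat_max_split _ A^o _ (idealization_set J [set: M]) c b).
  - by rewrite has_chain_between_idealize // has_chain_over_idealize // addnC.
  - exact: ideal_idealize_ideal.
  - exact: idealization_set_ideal.
  - exact: ideal_idealize_subT.
  - by rewrite /chains_le has_chain_between_idealize.
  - by rewrite /chains_le has_chain_over_idealize.
exact: ideal_smul_submodule.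
Qed.

End Idealization.

(** Stated for an arbitrary starting submodule so that the same generators serve above every JM. *)
Lemma fin_genP (R : comNzRingType) (V : lmodType R) : fin_gen V ->
  exists gens : seq V, forall U : set V, submodule U -> foldl adjoin U gens = setT.
Proof.
move=> [X /finite_seqP[s ->] XT]; exists s => U Us; apply/seteqP; split=> // v _.
have : Defs.span [set` s] v by rewrite XT.
apply: span_min; first exact: foldl_adjoin_submodule.
by move=> x xs; apply: mem_foldl_adjoin.
Qed.

Lemma nat_max_bound (S : set nat) b : (forall k, S k -> (k <= b)%N) -> (nat_max S <= b)%N.
Proof. by move=> Sb; rewrite /nat_max; case: xgetP => // n -> [/Sb]. Qed.

(** * Comparison of the sequences defining the h-functions *)

Section HFunction.
Context {K : realType} {R : comNzRingType} {m : set R}.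
Context (noethR : noetherian R) (localR : local_ring m).
Context (p : nat) (charR : p \in [pchar R]).

(** A prime over [I] contains the q-th powers of elements of [m], hence [m] itself, so
    [finite_colength] applies. *)
Lemma chains_le_over_frobenius I q : ideal I -> frobenius_pow m q `<=` I ->
  exists b, chains_le (over (I : set R^o)) b.
Proof.
move=> Is mI; apply: (finite_colength noethR localR Is) => P Pp IP.
apply: (prime_over_maximal noethR localR Pp) => a ma.
by apply: (prime_idealX (n := q) Pp); apply: IP; apply: mI; apply: mem_frobenius_pow.
Qed.

Context {M : lmodType R} (fgM : fin_gen M).

Lemma chains_le_quotient_module J q : ideal J -> frobenius_pow m q `<=` J ->
  exists b, chains_le (over (ideal_smul J [set: M])) b.
Proof.
move=> Js mJ; have [gens gensT] := fin_genP fgM.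
have [b Jb] := chains_le_over_frobenius Js mJ; exists (size gens * b)%N.
have Ss := ideal_smul_submodule J [set: M].
by apply: (chains_le_fin_gen Ss _ (gensT _ Ss) Jb) => a x Ja; apply: mem_ideal_smul.
Qed.

Local Notation A := (idealization M).
Local Notation mmM := (idealization_set m (ideal_smul m [set: M])).

Lemma h_seq_idealize (s : K) :
  h_seq p s mmM mmM A^o = h_seq p s m m R^o \+ h_seq p s m m M.
Proof.
apply/funext => e; rewrite /h_seq /= krull_dim_idealization.
set k := `|_|%N; rewrite -/(ideal_idealize m) ideal_pow_idealize.
have Ps := ideal_pow_ideal m k; have Fs := frobenius_pow_ideal m (p ^ e).
rewrite frobenius_pow_idealize // ideal_add_idealize //.
set I := ideal_add _ _; have Is : ideal I by apply: ideal_add_ideal.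
have FI : frobenius_pow m (p ^ e) `<=` I by apply: (@subset_addmr R R^o).
rewrite !ideal_smul_regular //; last exact: ideal_idealize_ideal.
have [b Ib] := chains_le_over_frobenius Is FI.
have [c Ic] := chains_le_quotient_module Is FI.
by rewrite (length_idealize Is Ib Ic) natrD mulrDl.
Qed.

Lemma h_seq_idealization_le (s : K) (e : nat) (n := idealization_set m [set: M]) :
  h_seq p s n n A^o e <= h_seq p s mmM mmM A^o e.
Proof.
rewrite /h_seq ler_pM2r ?invr_gt0 ?ltr0n ?expn_gt0 ?prime_gt0 ?(pcharf_prime charR) //.
set k := `|_|%N; rewrite ler_nat.
have nmm : mmM `<=` n by move=> z [].
rewrite -/(ideal_idealize m) in nmm *.
set In := ideal_add (ideal_pow n k) _.
have Ins : ideal In.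
  by apply: ideal_add_ideal; [apply: ideal_pow_ideal | apply: frobenius_pow_ideal].
have := ideal_add_sub (ideal_pow_sub (k := k) nmm) (frobenius_pow_sub (q := p ^ e) nmm).
rewrite -/In ideal_pow_idealize.
have Ps := ideal_pow_ideal m k; have Fs := frobenius_pow_ideal m (p ^ e).
rewrite frobenius_pow_idealize // ideal_add_idealize //.
set I := ideal_add (ideal_pow m k) _; have Is : ideal I by apply: ideal_add_ideal.
have FI : frobenius_pow m (p ^ e) `<=` I by apply: (@subset_addmr R R^o).
have IIs : ideal (ideal_idealize (M := M) I) by apply: ideal_idealize_ideal.
rewrite !ideal_smul_regular // => IIn.
have [b Ib] := chains_le_over_frobenius Is FI.
have [c Ic] := chains_le_quotient_module Is FI.
(* The smaller ideal has the longer quotient; its finite colength, from [chains_le_idealize], lets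
   [nat_max_le] compare the two. *)
rewrite !length_quotmod //; apply: nat_max_le (chains_le_idealize Is Ib Ic).
  by exists 0%N; exists (fun=> setT); split=> //; split=> //; split.
apply: has_chain_sub => U [Us InU]; split=> //; exact: subset_trans InU.
Qed.

Lemma annihilator_ideal : ideal (annihilator (V := M)).
Proof.
split=> [x|a b aM bM x|a b bM x]; first by rewrite scale0r.
  by rewrite scalerDl aM bM addr0.
by rewrite -scalerA bM scaler0.
Qed.

(** The bound comes from the Frobenius power alone and is uniform in [k], so [k] may later depend on
    [e]. *)
Lemma length_frobenius_quotient : (0 < krull_dim R)%N ->
  exists C, forall k e,
   (length (quotmod M (ideal_smul (ideal_add (ideal_pow m k)
      (frobenius_pow m (p ^ e))) setT)) <= (p ^ e) ^ module_dim M * C)%N.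
Proof.
move=> dimR; have As := annihilator_ideal; set r := module_dim M.
(* A positive [krull_dim] is a genuine maximum; it bounds the primes over Ann M and thereby makes
   [module_dim] a genuine bound too. *)
have chR : chains_le [set P | prime_ideal P /\ annihilator (V := M) `<=` P] (krull_dim R).
  move=> n nC; apply: (nat_max_ub dimR); apply: has_chain_sub nC.
  by move=> P [].
have chr : chains_le [set P | prime_ideal P /\ annihilator (V := M) `<=` P] r.
  by move=> n nC; have [|_] := nat_maxP _ chR; [exists n | apply].
have [xs [xsr xsm xsP]] := system_of_parameters noethR localR As chr.
have [b Hb] := finite_colength noethR localR (@foldl_adjoin_submodule R R^o xs _ As) xsP.
have [gens gensT] := fin_genP fgM; exists (size gens * b)%N => k e.
have := @chains_le_foldl_adjoinX _ xs _ _ (p ^ e)%N As Hb; rewrite xsr => Hq.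
set I := ideal_add _ _; have Ss := ideal_smul_submodule I [set: M].
rewrite length_quotmod // mulnCA; apply: nat_max_bound.
apply: (@chains_le_fin_gen _ _ _ gens _ _ Ss _ (gensT _ Ss) Hq) => a x Ja.
(* The colon ideal (IM : M) contains Ann M and the q-th powers of the parameters, hence the ideal
   they generate. *)
pose S : set R := [set a | forall y : M, ideal_smul I setT (a *: y)].
suff : S a by apply.
apply: (@foldl_adjoin_min R R^o _ _ S) Ja.
- have [S0 SD SZ] := Ss; split=> [y|u v Iu Iv y|u v Iv y] /=.
  + by rewrite scale0r.
  + by rewrite scalerDl; apply: SD.
  + by rewrite -scalerA; apply: SZ.
- by move=> u uM y; rewrite uM; case: Ss.
- move=> _ /mapP[u /xsm mu ->] y; apply: mem_ideal_smul => //.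
  apply: (@subset_addmr R R^o); first exact: ideal_pow_ideal.
  exact: mem_frobenius_pow.
Qed.

Lemma h_seq_small_cvg0 (s : K) : (module_dim M < krull_dim R)%N ->
  h_seq p s m m M @ \oo --> (0 : K).
Proof.
move=> dimM; have [C HC] := length_frobenius_quotient (leq_ltn_trans (leq0n _) dimM).
have p_pr := pcharf_prime charR; have p_gt0 := prime_gt0 p_pr.
have pK : (0 : K) < p%:R by rewrite ltr0n.
(* With r = dim M and d = dim R, r + 1 <= d bounds the e-th term by C p^(er - ed) <= C p^(-e),
   whence the ratio 1/p. *)
apply: (@squeeze_cvgr _ _ _ _ (fun=> 0) (geometric C%:R (p%:R^-1))).
- apply: nearW => e; apply/andP; split; first by rewrite /h_seq divr_ge0.
  rewrite /h_seq ler_pdivrMr ?ltr0n ?expn_gt0 ?p_gt0 //= -mulrA exprVn.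
  apply: (@le_trans _ _ (C%:R * (p ^ (e * module_dim M))%:R)).
    by rewrite -natrM ler_nat mulnC expnM; apply: HC.
  rewrite ler_wpM2l // mulrC ler_pdivlMr ?exprn_gt0 // -natrX -natrM ler_nat.
  by rewrite -expnD -mulnSr leq_pexp2l // leq_mul2l dimM orbT.
- exact: cvg_cst.
- apply: cvg_geometric; rewrite ger0_norm ?invr_ge0 ?ltW // invf_lt1 //.
  by rewrite ltr1n prime_gt1.
Qed.

End HFunction.

(* The cvgn hypotheses record the known existence of the limits defining
   h_s(R), h_s(M) and h_s(R |x M). The maximal ideal of R |x M is m |x M
   (local_ring_idealization). *)
Theorem corollary4p3 (K : realType) (R : comNzRingType) (m : set R) (p : nat)
    (M : lmodType R) (s : K)
    (noethR : noetherian R) (localR : local_ring m) (charR : p \in [pchar R])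
    (dimR : (0 < krull_dim R)%N) (fgM : fin_gen M) (s_gt0 : 0 < s)
    (cvg_hR : cvgn (h_seq p s m m R^o))
    (cvg_hM : cvgn (h_seq p s m m M))
    (cvg_hRM : cvgn (h_seq p s (idealization_set m [set: M])
                               (idealization_set m [set: M])
                               (idealization M)^o)) :
  let n := idealization_set m [set: M] in
  let mmM := idealization_set m (ideal_smul m [set: M]) in
  (h_module p s n (idealization M)^o <= h_ideal p s mmM /\
   h_ideal p s mmM = h_module p s m R^o + h_module p s m M) /\
  ((module_dim M < krull_dim R)%N ->
   h_module p s n (idealization M)^o <= h_ideal p s mmM /\
   h_ideal p s mmM = h_module p s m R^o).
Proof.
move=> n mmM; have mmME := h_seq_idealize noethR localR charR fgM s.
(* Convergence for [mmM] follows from the termwise sum, so that its [limn] is not a default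
   value. *)
have cvg_mm : cvgn (h_seq p s mmM mmM (idealization M)^o).
  by rewrite mmME; apply: is_cvgD cvg_hR cvg_hM.
have le_h : h_module p s n (idealization M)^o <= h_ideal p s mmM.
  apply: (ler_lim cvg_hRM cvg_mm).
  by apply: nearW => e; apply: (h_seq_idealization_le noethR localR charR fgM).
have h_split : h_ideal p s mmM = h_module p s m R^o + h_module p s m M.
  by rewrite /h_ideal /h_fun mmME; apply: limD cvg_hR cvg_hM.
split; first by split.
move=> dimM; split; first exact: le_h.
have h0 : h_module p s m M = 0.
  apply: (cvg_lim (@norm_hausdorff _ _)).
  exact: (h_seq_small_cvg0 noethR localR charR fgM).
by rewrite h_split h0 addr0.
Qed.
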